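(* Let $\mathfrak{g}$ be a complex semisimple Lie algebra and $V$ a finite dimensional complex $\mathfrak{g}$-module. Let $\mathfrak{h}$ be a Cartan subalgebra of $\mathfrak{g}$ with root system $\Phi\subset\mathrm{Hom}(\mathfrak{h},\mathbb{C})$, let $W\subset GL(\mathfrak{h})$ be the Weyl group, let $\mathfrak{C}$ be a Chevalley basis of $\mathfrak{g}$ determined by $\mathfrak{h}$, and let $\mathfrak{g}_0$ be the corresponding compact real form. For each $\sigma\in W$ there exists an element $T_\sigma$ in $G_{\mathbb{Z}}$ such that 1) $T_\sigma\circ H\circ T_\sigma^{-1}=\sigma(H)$ on $V$ for all $H\in\mathfrak{h}$. 2) $T_\sigma(V_\mu)=V_{\sigma(\mu)}$ for all $\mu\in\Lambda$, and $T_\sigma(V_0)=V_0$. 3) $T_\sigma$ is unitary with respect to any $\mathfrak{g}_0$-invariant Hermitian inner product $\langle\,,\rangle$ on $V$.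
   Context: For $\alpha\in\Phi$, $\tau_\alpha=2H_\alpha/B(H_\alpha,H_\alpha)\in\mathfrak{h}$, where $B$ is the Killing form and $B(H,H_\alpha)=\alpha(H)$ for $H\in\mathfrak{h}$. $\Delta$ is a base of $\Phi$, $\Phi^+$ the positive roots. A Chevalley basis determined by $\mathfrak{h}$ is a basis $\mathfrak{C}=\{X_\beta:\beta\in\Phi;\ \tau_\alpha:\alpha\in\Delta\}$ of $\mathfrak{g}$ with $X_\beta\in\mathfrak{g}_\beta$ (root space), $[X_\alpha,X_{-\alpha}]=\tau_\alpha$ for all $\alpha\in\Phi$, and, whenever $\alpha,\beta,\alpha+\beta\in\Phi$, $[X_\alpha,X_\beta]=C_{\alpha,\beta}X_{\alpha+\beta}$ with $C_{\alpha,\beta}=-C_{-\alpha,-\beta}$. The corresponding compact real form is $\mathfrak{g}_0=\mathbb{R}\text{-span}\{i\tau_\alpha\ (\alpha\in\Delta),\ X_\beta-X_{-\beta},\ iX_\beta+iX_{-\beta}\ (\beta\in\Phi^+)\}$. $\mathfrak{g}$ is regarded as a subalgebra of $\mathrm{End}(V)$, and $G$ is the connected Lie subgroup of $SL(V)$ with Lie algebra $\mathfrak{g}$. $G_{\mathbb{Z}}$ is the subgroup of $G$ generated by the elements $\exp(X_\alpha)$, $\alpha\in\Phi$. The Weyl group $W$ is generated by the reflections $\sigma_\alpha(H)=H-\alpha(H)\tau_\alpha$, $\alpha\in\Phi$, and acts on $\mathrm{Hom}(\mathfrak{h},\mathbb{C})$ by $\sigma(\lambda)(H)=\lambda(\sigma^{-1}H)$.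 $\Lambda$ is the set of nonzero weights of $V$, $V_\mu$ ($\mu\in\Lambda$) the weight spaces, $V_0$ the zero weight space. A Hermitian inner product on $V$ is $\mathfrak{g}_0$-invariant if every $X\in\mathfrak{g}_0$ is skew-Hermitian for it. *)

(* Defs.v *)
From HB Require Import structures.
From mathcomp Require Import all_boot all_order all_algebra.
From mathcomp Require Import complex.
From mathcomp Require Import all_classical all_reals all_analysis.

Set Implicit Arguments.
Unset Strict Implicit.
Unset Printing Implicit Defensive.

Import Order.TTheory GRing.Theory Num.Theory.
Import numFieldNormedType.Exports.

Local Open Scope classical_set_scope.
Local Open Scope ring_scope.

HB.mixin Record isLieAlgebra (K : fieldType) (g : Type) of Vector K g := {
  bracket : g -> g -> g;
  bracket_bilinear : bilinear_for *:%R *:%R bracket;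
  bracket_alt : forall x, bracket x x = 0;
  bracket_jacobi : forall x y z,
    bracket x (bracket y z) + bracket y (bracket z x)
      + bracket z (bracket x y) = 0
}.

#[short(type="lieAlgType")]
HB.structure Definition LieAlgebra (K : fieldType) :=
  {g of isLieAlgebra K g & Vector K g}.

Section LieAlgebras.
Variables (K : fieldType) (g : lieAlgType K).
Implicit Types (U I h : {vspace g}) (x y : g).

Definition bracketv U I : {vspace g} :=
  <<[seq bracket u v | u <- vbasis U, v <- vbasis I]>>%VS.

Definition solvable_sub U := exists n, iter n (fun I => bracketv I I) U = 0%VS.

Definition nilpotent_sub U := exists n, iter n (bracketv U) U = 0%VS.

Definition is_ideal I := forall x y, y \in I -> bracket x y \in I.

Definition is_semisimple := forall I, is_ideal I -> solvable_sub I -> I = 0%VS.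

Definition is_cartan h :=
  [/\ forall x y, x \in h -> y \in h -> bracket x y \in h,
      nilpotent_sub h
    & forall x, (forall y, y \in h -> bracket x y \in h) -> x \in h].

(* The trace of ad x \o ad y, computed in the basis vbasis fullv. *)
Definition killing x y : K :=
  \sum_(i < \dim {:g})
    coord (vbasis {:g}) i (bracket x (bracket y (vbasis {:g})`_i)).

Definition dual h := 'Hom(subvs_of h, K^o).

Definition root_vector h (a : dual h) (x : g) :=
  forall H : subvs_of h, bracket (vsval H) x = (a H : K) *: x.

Definition is_root h (a : dual h) :=
  a != 0 /\ exists2 x, x != 0 & root_vector a x.

Definition is_root_system h (Phi : seq (dual h)) :=
  uniq Phi /\ forall a, a \in Phi <-> is_root a.

Definition nat_comb h (Delta : seq (dual h)) (b : dual h) :=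
  exists c : dual h -> nat, b = \sum_(a <- Delta) a *+ c a.

Definition is_base h (Phi Delta : seq (dual h)) :=
  [/\ {subset Delta <= Phi}, basis_of fullv Delta
    & forall b, b \in Phi -> nat_comb Delta b \/ nat_comb Delta (- b)].

Definition is_pos_root h (Phi Delta : seq (dual h)) (b : dual h) :=
  b \in Phi /\ nat_comb Delta b.

(* Hd a is the vector H_a dual to the root a under the Killing form. *)
Definition is_killing_dual h (Phi : seq (dual h)) (Hd : dual h -> subvs_of h) :=
  forall a, a \in Phi -> forall H, killing (vsval H) (vsval (Hd a)) = a H.

Definition tau h (Hd : dual h -> subvs_of h) (a : dual h) : subvs_of h :=
  (2 / killing (vsval (Hd a)) (vsval (Hd a))) *: Hd a.

Definition is_chevalley_basis h (Phi Delta : seq (dual h))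
    (Hd : dual h -> subvs_of h) (X : dual h -> g) :=
  [/\ basis_of fullv
        ([seq X b | b <- Phi] ++ [seq vsval (tau Hd a) | a <- Delta]),
      forall b, b \in Phi -> root_vector b (X b),
      forall a, a \in Phi -> bracket (X a) (X (- a)) = vsval (tau Hd a)
    & exists C : dual h -> dual h -> K,
        forall a b, a \in Phi -> b \in Phi -> a + b \in Phi ->
          bracket (X a) (X b) = C a b *: X (a + b)
          /\ C a b = - C (- a) (- b)].

End LieAlgebras.

(* For a set S of automorphisms of U, the subgroup of GL(U) generated by S. *)
Inductive generated (K : fieldType) (U : vectType K) (S : set 'End(U)) :
    'End(U) -> Prop :=
| generated_id : generated S \1%VF
| generated_mem f of S f : generated S f
| generated_comp f1 f2 of generated S f1 & generated S f2 :
    generated S (f1 \o f2)%VF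
| generated_inv f of generated S f : generated S (f^-1)%VF.

Definition reflection (K : fieldType) (g : lieAlgType K) (h : {vspace g})
    (Hd : dual h -> subvs_of h) (a : dual h) : 'End(subvs_of h) :=
  linfun (fun H => H - (a H : K) *: tau Hd a).

Definition weyl_group (K : fieldType) (g : lieAlgType K) (h : {vspace g})
    (Phi : seq (dual h)) (Hd : dual h -> subvs_of h) :=
  generated [set reflection Hd a | a in [set` Phi]].

Definition weyl_act (K : fieldType) (g : lieAlgType K) (h : {vspace g})
    (s : 'End(subvs_of h)) (l : dual h) : dual h := (l \o s^-1)%VF.

Section Representations.
Variables (K : fieldType) (g : lieAlgType K) (V : vectType K).
Variables (rho : 'Hom(g, 'End(V))).

Definition is_rep :=
  forall x y, rho (bracket x y) = (rho x \o rho y)%VF - (rho y \o rho x)%VF.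

Definition weight_space (h : {vspace g}) (mu : dual h) : set V :=
  [set v | forall H : subvs_of h, rho (vsval H) v = (mu H : K) *: v].

Definition is_nonzero_weight (h : {vspace g}) (mu : dual h) :=
  mu != 0 /\ exists2 v, v != 0 & weight_space mu v.

End Representations.

Section Complex.
Variable R : realType.
Local Notation C := R[i].

(* E = exp A.  The series is taken to converge coordinatewise (equivalently,
   in the unique Hausdorff vector space topology of the finite dimensional
   space V). *)
Definition is_exp (V : vectType C) (A E : 'End(V)) :=
  forall (v : V) (f : 'Hom(V, C^o)),
    (fun N => f (\sum_(0 <= k < N) (k`!%:R)^-1 *: iter k A v) : C^o) @ \oo
      --> (f (E v) : C^o).

(* The exp (X a) lie in the Lie group G, so the subgroup of G that they
   generate is the subgroup of GL(V) that they generate. *)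
Definition G_Z (g : lieAlgType C) (V : vectType C) (rho : 'Hom(g, 'End(V)))
    (h : {vspace g}) (Phi : seq (dual h)) (X : dual h -> g) :=
  generated [set E | exists2 a, a \in Phi & is_exp (rho (X a)) E].

Inductive real_span (g : vectType C) (S : set g) : g -> Prop :=
| real_span0 : real_span S 0
| real_spanD (r : R) x y of S x & real_span S y :
    real_span S (r%:C%C *: x + y).

Inductive compact_generator (g : lieAlgType C) (h : {vspace g})
    (Phi Delta : seq (dual h)) (Hd : dual h -> subvs_of h) (X : dual h -> g) :
    g -> Prop :=
| compact_tau a of a \in Delta :
    compact_generator Phi Delta Hd X ('i%C *: vsval (tau Hd a))
| compact_sub b of is_pos_root Phi Delta b :
    compact_generator Phi Delta Hd X (X b - X (- b))
| compact_add b of is_pos_root Phi Delta b :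
    compact_generator Phi Delta Hd X ('i%C *: X b + 'i%C *: X (- b)).

Definition compact_form (g : lieAlgType C) (h : {vspace g})
    (Phi Delta : seq (dual h)) (Hd : dual h -> subvs_of h) (X : dual h -> g) :
    set g :=
  real_span (compact_generator Phi Delta Hd X).

Definition invariant_form (g : lieAlgType C) (V : vectType C)
    (rho : 'Hom(g, 'End(V))) (g0 : set g) (ip : {dot V for Num.conj}) :=
  forall x, g0 x -> forall u v, ip (rho x u) v = - ip u (rho x v).

Definition unitary_for (V : vectType C) (ip : {dot V for Num.conj})
    (T : 'End(V)) :=
  lker T == 0%VS /\ forall u v, ip (T u) (T v) = ip u v.

End Complex.

(* Main.v *)
Require Import Defs.
From HB Require Import structures.
From mathcomp Require Import all_boot all_order all_algebra.
From mathcomp Require Import complex.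
From mathcomp Require Import all_classical all_reals all_analysis.
Set Implicit Arguments.
Unset Strict Implicit.
Unset Printing Implicit Defensive.
Import Order.TTheory GRing.Theory Num.Theory.
Import numFieldNormedType.Exports.
Local Open Scope classical_set_scope.
Local Open Scope ring_scope.

(** For a root [a], let [e], [f] and [t] be the operators by which [X a],
    [X (- a)] and [tau Hd a] act on [V].  They form an sl2-triple, so [e] and
    [f] are nilpotent and their exponentials are finite sums lying in [G_Z].
    The reflection in [a] is realised by

      [T = exp e \o exp (- f) \o exp e].

    Conjugation by [exp e] acts as [exp (ad e)], whose series stops after the
    square on all the operators that matter here; carrying this out for the
    three factors gives [T H T^-1 = H - a(H) t] for [H] in the Cartan subalgebra
    (weyl_lift_weight) and [T e T^-1 = - f] (weyl_lift_raise).  The latter turns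
    [T exp(e)] into [exp(- f) T], whence [T] is also [exp(-f) exp(e) exp(-f)]
    (weyl_lift_swap).  An inner product invariant under the compact form makes
    [f] the adjoint of [e], because [X a - X (- a)] and ['i (X a + X (- a))] act
    by skew-Hermitian operators; the adjoint of the first expression of [T] is
    then visibly the inverse of the second one, and [T] is unitary.  Elements of
    the Weyl group are products of reflections and of inverses, and the
    properties of [T] are stable under products and inverses.  That [T] permutes
    the weight spaces is a formal consequence of the conjugation formula.

    The work on the Lie algebra side is to know that each root does give an
    sl2-triple, that is, that [- a] is a root and that [a (Hd a)], the Killing
    norm of [Hd a], is not zero (root_opp, root_Hd_neq0).  Both are read off the
    Chevalley basis.  Roots separate the points of [h], hence [h] is abelian and
    has the vectors [tau Hd a], [a] simple, as a basis.  If [tau Hd a] is not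
    zero, then bracketing with [X a] reaches a nonzero vector of weight 0, which
    forces [- a] to be a root.  This applies to simple roots, whose [tau Hd a]
    belong to a basis; the theory of sl2 then makes the values of roots on these
    vectors real.  As every root is an integral combination of simple ones,
    roots take real values on all the [Hd a], and the Killing norm of [Hd a] is
    a sum of squares of real numbers, not all of them zero. *)

(** * Exponentials of nilpotent operators *)

Section NilpotentExp.
Variables (K : numFieldType) (V : vectType K).
Implicit Types (x y A : 'End(V)) (v : V) (N : nat).

(** The truncation of the exponential series at order [N]: it is used when
    [A] to the [N] is zero, and then agrees with [exp A]. *)
Definition lexp N A : 'End(V) :=
  \sum_(0 <= k < N) (k`!%:R)^-1 *: iter k (comp_lfun A) \1%VF.

Lemma lexpE N A v :
  lexp N A v = \sum_(0 <= k < N) (k`!%:R)^-1 *: iter k A v.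
Proof.
rewrite /lexp sum_lfunE; apply: eq_bigr => k _; rewrite scale_lfunE.
congr (_ *: _); elim: k => [|k IHk] /=; first by rewrite id_lfunE.
by rewrite comp_lfunE IHk.
Qed.

Lemma iter0_le N A v M : (forall u, iter N A u = 0) -> (N <= M)%N ->
  iter M A v = 0.
Proof. by move=> A0 /subnK <-; rewrite addnC iterD A0. Qed.

Lemma lexp_widen N A M : (forall u, iter N A u = 0) -> (N <= M)%N ->
  lexp M A = lexp N A.
Proof.
move=> A0 leNM; apply/lfunP => v.
rewrite !lexpE (big_cat_nat (leq0n N) leNM) //=.
rewrite [X in _ + X]big_nat_cond [X in _ + X]big1 ?addr0 // => k.
by rewrite andbT => /andP[leNk _]; rewrite (iter0_le v A0 leNk) scaler0.
Qed.

(** With [y1 = [x, y]] and [y2 = [x, y1]] commuting with [x], this is the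
    Leibniz rule for [ad x], written for powers of [x] moved to the right of
    [y]; the coefficients are binomial.  For small [k] the exponents [k.-1] and
    [k.-2] are truncated, but then the coefficient in front is zero. *)
Lemma iter_commutator x y y1 y2 :
    (forall v, x (y v) = y (x v) + y1 v) ->
    (forall v, x (y1 v) = y1 (x v) + y2 v) ->
    (forall v, x (y2 v) = y2 (x v)) ->
  forall k v, iter k x (y v) = y (iter k x v)
    + k%:R *: y1 (iter k.-1 x v) + 'C(k, 2)%:R *: y2 (iter k.-2 x v).
Proof.
move=> xy xy1 xy2; elim=> [|k IHk] v; first by rewrite bin0n !scale0r !addr0.
rewrite iterS IHk !linearD !linearZ /= xy xy1 xy2 scalerDr.
have -> : k%:R *: y1 (x (iter k.-1 x v)) = k%:R *: y1 (iter k x v).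
  by case: (k) => [|m] //; rewrite !scale0r.
have -> : 'C(k, 2)%:R *: y2 (x (iter k.-2 x v))
        = 'C(k, 2)%:R *: y2 (iter k.-1 x v).
  by case: (k) => [|[|m]] //; rewrite !scale0r.
rewrite binS bin1 natrD scalerDl -natr1 scalerDl scale1r.
by rewrite !addrA [LHS](ACl (1*3*2*5*4)).
Qed.

(** The identity [exp(x) y exp(-x) = exp(ad x) y], in the case where the
    series on the right stops after the quadratic term. *)
Lemma lexp_commutator N x y y1 y2 :
    (forall u, iter N x u = 0) ->
    (forall v, x (y v) = y (x v) + y1 v) ->
    (forall v, x (y1 v) = y1 (x v) + y2 v) ->
    (forall v, x (y2 v) = y2 (x v)) ->
  forall v, lexp N x (y v)
    = y (lexp N x v) + y1 (lexp N x v) + 2^-1 *: y2 (lexp N x v).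
Proof.
move=> x0 xy xy1 xy2 v.
have xw m : lexp N x = lexp (N + m) x by rewrite (lexp_widen x0) ?leq_addr.
have fact_inv k : (k.+1`!%:R)^-1 * k.+1%:R = (k`!%:R)^-1 :> K.
  by rewrite factS natrM invfM mulrAC mulVf ?mul1r // pnatr_eq0.
(* The three terms of the Leibniz rule shift the index by 0, 1 and 2; the
   exponential is truncated accordingly so that the ranges match. *)
rewrite {1}(xw 2%N) {1}(xw 2%N) {1}(xw 1%N) !lexpE.
under eq_bigr => k _ do
  rewrite (iter_commutator xy xy1 xy2) !scalerDr !scalerA.
rewrite !big_split /= !linear_sum /=; congr (_ + _ + _).
- by apply: eq_bigr => k _; rewrite linearZ.
- rewrite addn2 big_nat_recl //= mulr0 scale0r add0r addn1.
  by apply: eq_bigr => k _; rewrite fact_inv linearZ.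
rewrite addn2 !big_nat_recl //= !mulr0 !scale0r !add0r.
apply: eq_bigr => k _; rewrite linearZ scalerA; congr (_ *: _).
have -> : 'C(k.+2, 2)%:R = k.+2%:R * k.+1%:R / 2 :> K.
  apply: (mulIf (x := 2)); first by rewrite pnatr_eq0.
  by rewrite divfK ?pnatr_eq0 // -!natrM (bin_ffact k.+2 2) !ffactnS ffactn0
    muln1.
by rewrite !mulrA fact_inv fact_inv mulrC.
Qed.

Lemma iter_opp x k v : iter k (- x) v = (-1) ^+ k *: iter k x v.
Proof.
elim: k => [|k IHk]; first by rewrite expr0 scale1r.
by rewrite !iterS IHk opp_lfunE linearZ /= exprS -scalerA scaleN1r.
Qed.

(** The coefficients of the product of the series of [exp z] and [exp (- z)],
    which are those of [(1 - 1) ^+ m / m`!]. *)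
Lemma sum_alternating_fact m :
  \sum_(0 <= k < m.+1) ((-1) ^+ k / k`!%:R) * ((m - k)`!%:R)^-1
    = (m == 0)%:R :> K.
Proof.
have fact0 k : k`!%:R != 0 :> K by rewrite pnatr_eq0 -lt0n fact_gt0.
transitivity ((m`!%:R)^-1 * (1 - 1) ^+ m : K); last first.
  by rewrite subrr expr0n; case: m => [|m]; rewrite ?mulr0 // mulr1 invr1.
rewrite exprBn big_mkord mulr_sumr; apply: eq_bigr => k _.
have lekm : (k <= m)%N by rewrite -ltnS.
rewrite !expr1n !mulr1 -(mulr_natr _ 'C(m, k)) mulrCA -mulrA; congr (_ * _).
have bin0 : 'C(m, k)%:R != 0 :> K by rewrite pnatr_eq0 -lt0n bin_gt0.
by rewrite -(bin_fact lekm) !natrM !invfM [RHS]mulrC mulVKf.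
Qed.

(** The Cauchy product of the two series, in which the terms of total degree
    at least [N] vanish; so the double sum may be restricted to a triangle. *)
Lemma lexp_oppK N x : (forall u, iter N x u = 0) ->
  cancel (lexp N (- x)) (lexp N x).
Proof.
move=> x0 v; rewrite [lexp N (- x) v]lexpE linear_sum /=.
transitivity (\sum_(0 <= k < N) \sum_(0 <= m < N | (k <= m)%N)
    (((-1) ^+ k / k`!%:R) * ((m - k)`!%:R)^-1) *: iter m x v).
  rewrite !big_nat; apply: eq_bigr => k /andP[_ ltkN].
  rewrite iter_opp !linearZ /= scalerA lexpE [(-1) ^+ k / _]mulrC.
  under [RHS]eq_bigr => m _ do rewrite -scalerA.
  rewrite -scaler_sumr; congr (_ *: _).
  transitivity (\sum_(k <= m < N) ((m - k)`!%:R)^-1 *: iter m x v); last first.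
    by rewrite (big_nat_widenl k 0).
  rewrite -[k in RHS]add0n big_addn.
  rewrite (big_cat_nat (leq0n (N - k)) (leq_subr k N)) /=.
  rewrite [X in _ + X]big_nat [X in _ + X]big1 ?addr0 => [|j /andP[leNkj _]].
    by apply: eq_bigr => j _; rewrite addnK -iterD.
  by rewrite -iterD (iter0_le v x0) ?scaler0 // addnC -leq_subLR.
rewrite (exchange_big_dep_nat xpredT) //=.
transitivity (\sum_(0 <= m < N) (m == 0)%:R *: iter m x v).
  rewrite !big_nat; apply: eq_bigr => m /andP[_ ltmN].
  rewrite -scaler_suml -sum_alternating_fact; congr (_ *: _).
  by rewrite (big_nat_widen 0 m.+1 N).
case: N x0 => [|N] x0; first by rewrite big_nil; exact: esym (x0 v).
rewrite big_nat_recl // scale1r big1 ?addr0 // => m _.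
by rewrite scale0r.
Qed.

Lemma lexp_opp_inv N x : (forall v, iter N x v = 0) ->
  lexp N (- x) = (lexp N x)^-1%VF /\ lker (lexp N x) == 0%VS.
Proof.
move=> x0; have nx0 v : iter N (- x) v = 0 by rewrite iter_opp x0 scaler0.
have ker0 : lker (lexp N x) == 0%VS.
  apply/lker0P; apply: (can_inj (g := lexp N (- x))).
  by have := lexp_oppK nx0; rewrite opprK.
split=> //; apply/lfunP => v.
by rewrite -[v in RHS](lexp_oppK x0) lker0_lfunK.
Qed.

Lemma lker0_comp (A B : 'End(V)) :
  lker A == 0%VS -> lker B == 0%VS -> lker (A \o B)%VF == 0%VS.
Proof.
move=> /lker0P Ai /lker0P Bi; apply/lker0P => u v; rewrite !comp_lfunE.
by move=> /Ai /Bi.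
Qed.

Lemma lker0_inv (A : 'End(V)) : lker A == 0%VS -> lker (A^-1)%VF == 0%VS.
Proof. by move=> A0; apply/lker0P; apply: can_inj (lker0_lfunVK A0). Qed.

End NilpotentExp.

(** * Sl2-triples of operators *)

Section Eigenvalues.
Import VectorInternalTheory.
Variables (K : numFieldType) (U : vectType K).

(** The characteristic polynomial cannot have more than [dim U] roots. *)
Lemma eigenvector_seq0 (A : 'End(U)) (lam : nat -> K) (w : nat -> U) :
  injective lam -> (forall k, A (w k) = lam k *: w k) -> exists k, w k = 0.
Proof.
move=> lam_inj Aw; have [/existsP[k /eqP wk0]|] :=
  boolP [exists k : 'I_(dim U).+1, w k == 0]; first by exists k.
rewrite negb_exists => /forallP w0.
have := @max_poly_roots _ (char_poly (f2mx A))
  [seq lam k | k <- iota 0 (dim U).+1].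
rewrite size_char_poly size_map size_iota ltnn => /(_ _ _ _)/negP[].
- exact: monic_neq0 (char_poly_monic _).
- apply/allP => a /mapP[k]; rewrite mem_iota => /= ltk ->.
  rewrite -eigenvalue_root_char; apply/eigenvalueP.
  exists (v2r (w k)); last first.
    have := w0 (Ordinal ltk); apply: contra => /eqP.
    by move=> /(congr1 r2v); rewrite v2rK linear0 /= => ->.
  rewrite -linearZ -Aw unlock /= r2vK //.
- by rewrite map_inj_uniq ?iota_uniq.
- by [].
Qed.

End Eigenvalues.

Section Sl2.
Variables (K : numFieldType) (U : vectType K).

Lemma iterZ (A : 'End(U)) (a : K) k v : iter k A (a *: v) = a *: iter k A v.
Proof. by elim: k => [|k IHk] //; rewrite !iterS IHk linearZ. Qed.

Lemma iter_lfun0 (A : 'End(U)) k : iter k A 0 = 0.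
Proof. by elim: k => [|k IHk] //; rewrite iterS IHk linear0. Qed.

Lemma iter_ad (t e : 'End(U)) (c : K) :
    (forall v, t (e v) = e (t v) + c *: e v) ->
  forall k v, t (iter k e v) = iter k e (t v) + (k%:R * c) *: iter k e v.
Proof.
move=> te; elim=> [|k IHk] v; first by rewrite mul0r scale0r addr0.
rewrite !iterS te IHk linearD linearZ /= -addrA -scalerDl.
by rewrite -[in RHS]natr1 mulrDl mul1r.
Qed.

(** The powers [e ^+ k] satisfy [[t, e ^+ k] = k c e ^+ k]: were they all
    nonzero, [ad t] would have infinitely many eigenvalues on ['End(U)]. *)
Lemma nilpotent_of_ad (t e : 'End(U)) (c : K) : c != 0 ->
    (forall v, t (e v) = e (t v) + c *: e v) ->
  exists N, forall v, iter N e v = 0.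
Proof.
move=> c0 te.
pose ek k : 'End(U) := iter k (comp_lfun e) \1%VF.
have ekE k v : ek k v = iter k e v.
  elim: k => [|k IHk] /=; first by rewrite id_lfunE.
  by rewrite comp_lfunE IHk.
pose ad_t (B : 'End(U)) : 'End(U) := (t \o B)%VF - (B \o t)%VF.
have ad_t_linear : linear ad_t.
  move=> a B B'; rewrite /ad_t comp_lfunDr comp_lfunDl.
  by rewrite -comp_lfunZl -comp_lfunZr scalerBr opprD addrACA.
pose ad_tL := GRing.isLinear.Build _ _ _ _ ad_t ad_t_linear.
pose adt : {linear _ -> _} := HB.pack ad_t ad_tL.
have [||N eN] := @eigenvector_seq0 K _ (linfun adt) (fun k => k%:R * c) ek.
- by move=> j k /(mulIf c0)/eqP; rewrite eqr_nat => /eqP.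
- move=> k; apply/lfunP => v; rewrite lfunE /= /ad_t scale_lfunE add_lfunE.
  by rewrite opp_lfunE !comp_lfunE !ekE (iter_ad te) addrAC subrr add0r.
by exists N => v; rewrite -ekE eN zero_lfunE.
Qed.

Definition sl2_triple (e f t : 'End(U)) :=
  [/\ forall v, e (f v) = f (e v) + t v,
      forall v, t (e v) = e (t v) + 2 *: e v
    & forall v, t (f v) = f (t v) - 2 *: f v].

(** This symmetry gives the effect of [exp (- f)] from that of [exp e]. *)
Lemma sl2_triple_swap e f t : sl2_triple e f t -> sl2_triple (- f) (- e) (- t).
Proof.
case=> ef te tf; split=> v; rewrite !opp_lfunE !linearN !opprK //=.
by rewrite ef addrK.
Qed.

Lemma sl2_triple_nilpotent e f t : sl2_triple e f t ->
  exists N, (forall v, iter N e v = 0) /\ (forall v, iter N f v = 0).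
Proof.
case=> _ te tf.
have [|N1 e0] := nilpotent_of_ad _ te; first by rewrite pnatr_eq0.
have [||N2 f0] := @nilpotent_of_ad t f (-2).
- by rewrite oppr_eq0 pnatr_eq0.
- by move=> v; rewrite tf scaleNr.
exists (maxn N1 N2); split=> v; first exact: (iter0_le v e0 (leq_maxl _ _)).
exact: (iter0_le v f0 (leq_maxr _ _)).
Qed.

Lemma last_nonzero_iter N (A : 'End(U)) v : (forall u, iter N A u = 0) ->
  v != 0 -> exists2 k, iter k A v != 0 & A (iter k A v) = 0.
Proof.
move=> A0 v0; have exk : exists k, iter k A v == 0 by exists N; rewrite A0.
case: (ex_minnP exk) => -[|k] /eqP Ak min_k.
  by rewrite [v]Ak eqxx in v0.
by exists k => //; apply/negP => /min_k; rewrite ltnn.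
Qed.

(** The eigenvalue is in fact an integer.  Raising [v] by [e] as far as
    possible gives a highest weight vector [w], of weight [b = a + 2 m].  If [k]
    is the largest integer such that [f ^+ k w] is not zero, moving [f ^+ k.+1]
    across [e] in [f ^+ k.+1 (e w) = 0] yields [b = k]. *)
Lemma sl2_eigenvalue_real e f t (a : K) v : sl2_triple e f t ->
  v != 0 -> t v = a *: v -> a \is Num.real.
Proof.
move=> sl2; have [N [e0 f0]] := sl2_triple_nilpotent sl2.
case: sl2 => ef te tf v0 tv.
have [m] := last_nonzero_iter e0 v0.
have := iter_ad te m v; set w := iter m e v.
rewrite tv iterZ -/w -scalerDl; set b := _ + _ => tw w0 ew.
have [k] := last_nonzero_iter f0 w0.
have tf' u : t (f u) = f (t u) + (-2) *: f u by rewrite tf scaleNr.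
have := iter_ad tf' k w; rewrite tw iterZ -scalerDl.
set z := iter k f w => tz z0 fz.
have bk : b = k%:R.
  have : iter k.+1 f (e w) = e (iter k.+1 f w) + k.+1%:R *: (- t)%R (iter k f w)
      + 'C(k.+1, 2)%:R *: ((-2) *: f) (iter k.-1 f w).
    apply: iter_commutator => u.
    - by rewrite ef opp_lfunE addrK.
    - by rewrite !opp_lfunE linearN /= scale_lfunE tf' opprD subrK.
    - by rewrite !scale_lfunE linearZ.
  rewrite ew iter_lfun0 iterS -/z fz linear0 add0r opp_lfunE tz.
  rewrite scale_lfunE.
  have -> : 'C(k.+1, 2)%:R *: ((-2) *: f (iter k.-1 f w))
          = ('C(k.+1, 2)%:R * -2) *: z.
    by rewrite /z; case: (k) => [|j]; rewrite ?scalerA // !mul0r !scale0r.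
  rewrite scalerN scalerA -scaleNr -scalerDl => /esym/eqP.
  rewrite scaler_eq0 (negPf z0) orbF => /eqP.
  have -> : 'C(k.+1, 2)%:R * -2 = - (k.+1%:R * k%:R) :> K.
    by rewrite mulrN -!natrM (bin_ffact k.+1 2) !ffactnS ffactn0 muln1.
  rewrite -opprD -mulrDr => /eqP; rewrite oppr_eq0 mulf_eq0 pnatr_eq0 /=.
  rewrite mulrN mulr_natr mulr2n opprD addrA subrK.
  by rewrite subr_eq0 => /eqP.
have -> : a = k%:R - m%:R * 2 by rewrite -bk /b addrK.
by rewrite rpredB ?rpredM ?realn.
Qed.

End Sl2.

(** * The operator exp(e) exp(-f) exp(e) *)

Section WeylLift.
Variables (K : numFieldType) (U : vectType K).
Implicit Types (e f t H : 'End(U)) (c : K) (N : nat).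

(** Here [[e, H] = - c e] commutes with [e], so the series is linear in [e]. *)
Lemma lexp_weight N e H c : (forall v, iter N e v = 0) ->
    (forall v, H (e v) = e (H v) + c *: e v) ->
  forall v, lexp N e (H v) = H (lexp N e v) - c *: e (lexp N e v).
Proof.
move=> e0 He v.
rewrite (@lexp_commutator K U N e H (- c *: e) 0) // => [|u|u|u].
- by rewrite zero_lfunE scaler0 addr0 scale_lfunE scaleNr.
- by rewrite He scale_lfunE scaleNr addrK.
- by rewrite !scale_lfunE linearZ zero_lfunE addr0.
- by rewrite !zero_lfunE linear0.
Qed.

Lemma lexp_self N e : (forall v, iter N e v = 0) ->
  forall v, lexp N e (e v) = e (lexp N e v).
Proof.
move=> e0 v; rewrite (@lexp_weight N e e 0 e0) ?scale0r ?subr0 // => u.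
by rewrite scale0r addr0.
Qed.

(** The quadratic term is [[e, [e, f]] / 2 = [e, t] / 2 = - e]. *)
Lemma lexp_sl2_lower N e f t : (forall v, iter N e v = 0) ->
    sl2_triple e f t ->
  forall v, lexp N e (f v) = f (lexp N e v) + t (lexp N e v) - e (lexp N e v).
Proof.
move=> e0 [ef te _] v.
rewrite (@lexp_commutator K U N e f t (-2 *: e)) // => [|u|u].
- by rewrite scale_lfunE scalerA mulrN mulVf ?pnatr_eq0 // scaleN1r.
- by rewrite te scale_lfunE scaleNr addrK.
- by rewrite !scale_lfunE linearZ.
Qed.

(** The image under a representation of SL(2) of the matrix with rows
    [(0, 1)] and [(-1, 0)], a representative of the nontrivial Weyl group
    element of SL(2). *)
Definition weyl_lift N e f : 'End(U) :=
  (lexp N e \o lexp N (- f) \o lexp N e)%VF.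

Section Triple.
Variables (N : nat) (e f t : 'End(U)).
Hypotheses (e0 : forall v, iter N e v = 0) (f0 : forall v, iter N f v = 0).
Hypothesis sl2 : sl2_triple e f t.
Let E := lexp N e.
Let F := lexp N (- f).
Let T := weyl_lift N e f.

Let TE v : T v = E (F (E v)).
Proof. by rewrite /T /weyl_lift !comp_lfunE. Qed.

Let Nf0 v : iter N (- f) v = 0.
Proof. by rewrite iter_opp f0 scaler0. Qed.

Let lexp_opp_raise v : F (e v) = e (F v) + t (F v) - f (F v).
Proof.
have := lexp_sl2_lower Nf0 (sl2_triple_swap sl2) v.
rewrite !opp_lfunE linearN /= => /(congr1 -%R).
by rewrite !opprK !opprD !opprK.
Qed.

Lemma weyl_lift_weight H c :
    (forall v, H (e v) = e (H v) + c *: e v) ->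
    (forall v, H (f v) = f (H v) - c *: f v) ->
  forall v, T (H v) = H (T v) - c *: t (T v).
Proof.
move=> He Hf v; rewrite !TE; set w := F (E v).
have FH u : F (H u) = H (F u) - c *: f (F u).
  rewrite (@lexp_weight N (- f) H (- c)) // => [|z].
    by rewrite opp_lfunE scalerN scaleNr opprK.
  by rewrite !opp_lfunE linearN /= Hf scaleNr scalerN opprK opprB addrC.
have [_ te _] := sl2.
rewrite (lexp_weight e0 He) linearB linearZ /= FH lexp_opp_raise -/w.
rewrite -addrA -opprD -scalerDr [f w + _]addrC subrK linearB linearZ linearD /=.
rewrite (lexp_weight e0 He) (lexp_self e0) (lexp_weight e0 te) -addrA -opprD.
rewrite -scalerDr; congr (_ - _ *: _).
by rewrite addrA -mulr2n -scaler_nat addrC subrK.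
Qed.

Lemma weyl_lift_raise v : T (e v) = - f (T v).
Proof.
have [_ te _] := sl2.
rewrite !TE (lexp_self e0) lexp_opp_raise linearB linearD /= (lexp_self e0).
rewrite (lexp_weight e0 te) (lexp_sl2_lower e0 sl2).
rewrite -/E; set z := E (F (E v)).
rewrite scaler_nat mulr2n opprD [e z + _]addrCA addNKr -[f z + _ - _]addrA.
by rewrite opprD addrCA subrr addr0.
Qed.

Lemma weyl_lift_lexp v : T (E v) = F (T v).
Proof.
rewrite !lexpE linear_sum; apply: eq_bigr => k _; rewrite linearZ /=.
congr (_ *: _); elim: k => [|k IHk] //.
by rewrite !iterS weyl_lift_raise opp_lfunE IHk.
Qed.

(** In SL(2) this is the identity expressing [(0, 1; -1, 0)] as a product
    of elementary matrices in two ways; it follows from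
    [T exp(e) = exp(-f) T]. *)
Lemma weyl_lift_swap : T = weyl_lift N (- f) (- e).
Proof.
apply/lfunP => v; rewrite /weyl_lift opprK !comp_lfunE.
rewrite -[v](lexp_oppK e0); set u := lexp N (- e) v.
by have := weyl_lift_lexp u; rewrite !TE.
Qed.

End Triple.
End WeylLift.

(** * Lie algebras, root vectors and traces *)

Section AdjointRep.
Variables (K : fieldType) (g : lieAlgType K).
Implicit Types (x y z : g) (h : {vspace g}).

Fact bracket_is_linear x : linear (bracket x).
Proof. exact: (bracket_bilinear.2 x). Qed.

HB.instance Definition _ x :=
  GRing.isLinear.Build K g g *:%R (bracket x) (bracket_is_linear x).

Lemma bracketPl a x y z :
  bracket (a *: x + y) z = a *: bracket x z + bracket y z.
Proof. exact: (bracket_bilinear.1 z). Qed.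

Lemma bracketC x y : bracket x y = - bracket y x.
Proof.
apply/eqP; rewrite -addr_eq0; have := bracket_alt (x + y).
rewrite linearD /= -{1 3}[x]scale1r !bracketPl !bracket_alt !scale1r.
by rewrite add0r addr0 addrC => ->.
Qed.

Lemma bracketZl a x y : bracket (a *: x) y = a *: bracket x y.
Proof. by rewrite bracketC linearZ -scalerN /= -bracketC. Qed.

Lemma bracket_bracketl x y z :
  bracket (bracket x y) z = bracket x (bracket y z) - bracket y (bracket x z).
Proof.
rewrite bracketC [bracket x z]bracketC linearN /= opprK.
by apply/esym/eqP; rewrite -subr_eq0 opprK bracket_jacobi.
Qed.

Definition ad_fun x : 'End(g) := linfun (bracket x).

Fact ad_is_linear : linear ad_fun.
Proof.
move=> a x y; apply/lfunP => z.
by rewrite add_lfunE scale_lfunE !lfunE /= bracketPl.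
Qed.

HB.instance Definition _ :=
  GRing.isLinear.Build K g 'End(g) *:%R ad_fun ad_is_linear.

Definition ad : 'Hom(g, 'End(g)) := linfun ad_fun.

Lemma adE x y : ad x y = bracket x y.
Proof. by rewrite /ad !lfunE. Qed.

Lemma ad_rep : is_rep ad.
Proof.
move=> x y; apply/lfunP => z.
by rewrite add_lfunE opp_lfunE !comp_lfunE !adE bracket_bracketl.
Qed.

Lemma root_vector_bracket h (a b : dual h) x y :
  root_vector a x -> root_vector b y -> root_vector (a + b) (bracket x y).
Proof.
move=> ax bY H.
have -> : bracket (vsval H) (bracket x y)
        = bracket (bracket (vsval H) x) y + bracket x (bracket (vsval H) y).
  by rewrite bracket_bracketl subrK.
by rewrite ax bY bracketZl linearZ /= -scalerDl add_lfunE.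
Qed.

End AdjointRep.

Section Representation.
Variables (K : fieldType) (g : lieAlgType K) (V : vectType K).
Variables (rho : 'Hom(g, 'End(V))).
Hypothesis rho_rep : is_rep rho.

Lemma rep_subZ x (c : K) y v : rho (x - c *: y) v = rho x v - c *: rho y v.
Proof. by rewrite linearB linearZ add_lfunE opp_lfunE scale_lfunE. Qed.

Lemma rep_bracket x y v :
  rho x (rho y v) = rho y (rho x v) + rho (bracket x y) v.
Proof.
by rewrite rho_rep add_lfunE opp_lfunE !comp_lfunE addrC subrK.
Qed.

Lemma rep_root_vector h (a : dual h) x (H : subvs_of h) v : root_vector a x ->
  rho (vsval H) (rho x v) = rho x (rho (vsval H) v) + (a H : K) *: rho x v.
Proof. by move=> ax; rewrite rep_bracket ax linearZ scale_lfunE. Qed.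

End Representation.

Section Trace.
Variables (K : fieldType) (U : vectType K).

Lemma trace_basis n m (X : n.-tuple U) (Y : m.-tuple U) (phi : 'End(U)) :
    basis_of fullv X -> basis_of fullv Y ->
  \sum_(i < n) coord X i (phi X`_i) = \sum_(j < m) coord Y j (phi Y`_j).
Proof.
move=> bX bY.
transitivity (\sum_(i < n) \sum_(j < m)
    coord X i Y`_j * coord Y j (phi X`_i)).
  apply: eq_bigr => i _.
  rewrite {1}(coord_basis bY (memvf (phi X`_i))) linear_sum.
  by apply: eq_bigr => j _; rewrite linearZ mulrC.
rewrite exchange_big; apply: eq_bigr => j _ /=.
rewrite {2}(coord_basis bX (memvf Y`_j)) !linear_sum.
by apply: eq_bigr => i _; rewrite !linearZ.
Qed.

(** Reads the trace of a diagonalisable operator from the list [c] of its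
    eigenvalues, counted along an eigenbasis [s]. *)
Lemma trace_diagonal n (X : n.-tuple U) (phi : 'End(U))
    (s : seq U) (c : seq K) :
    basis_of fullv X -> basis_of fullv s -> size c = size s ->
    (forall i, (i < size s)%N -> phi s`_i = c`_i *: s`_i) ->
  \sum_(i < n) coord X i (phi X`_i) = \sum_(a <- c) a.
Proof.
move=> bX bs szc phis; rewrite (trace_basis phi bX (Y := in_tuple s)) //.
rewrite (big_nth 0) big_mkord szc; apply: eq_bigr => i _.
rewrite phis // linearZ /= -[s`_i]/((in_tuple s)`_i) coord_free ?eqxx ?mulr1 //.
exact: basis_free bs.
Qed.

End Trace.

(** * Roots and Chevalley bases *)

Section ChevalleyBasis.
Variables (K : numFieldType) (g : lieAlgType K) (h : {vspace g}).
Variables (Phi Delta : seq (dual h)) (Hd : dual h -> subvs_of h).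
Variable X : dual h -> g.
Hypotheses (h_cartan : is_cartan h) (Phi_roots : is_root_system Phi).
Hypotheses (Hd_dual : is_killing_dual Phi Hd) (Delta_base : is_base Phi Delta).
Hypothesis X_chevalley : is_chevalley_basis Phi Delta Hd X.
Implicit Types (a b c : dual h) (H : subvs_of h) (x y : g).

Lemma base_separates H : (forall a, a \in Delta -> (a H : K) = 0) -> H = 0.
Proof.
have [_ Delta_basis _] := Delta_base.
move=> DH0; have dH0 (l : dual h) : (l H : K) = 0.
  rewrite (coord_basis (X := in_tuple Delta) Delta_basis (memvf l)).
  rewrite sum_lfunE big1 // => i _.
  by rewrite scale_lfunE DH0 ?scaler0 // mem_nth.
rewrite (coord_vbasis (memvf H)) big1 // => i _.
have := dH0 (linfun (coord (vbasis {:subvs_of h}) i : subvs_of h -> K^o)).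
by rewrite lfunE /= => ->; rewrite scale0r.
Qed.

Lemma root_neq0 a : a \in Phi -> a != 0.
Proof. by case: Phi_roots => _ Pa /Pa[]. Qed.

(** A root kills every commutator of elements of [h], since these act on a
    root vector by scalars, which commute; and simple roots separate [h]. *)
Lemma cartan_abelian x y : x \in h -> y \in h -> bracket x y = 0.
Proof.
move=> hx hy; have [h_closed _ _] := h_cartan.
have hxy := h_closed x y hx hy.
rewrite -(vsprojK hxy) (@base_separates (vsproj h (bracket x y))) ?linear0 //.
move=> a Da; have [DPhi _ _] := Delta_base.
have [_ /(_ a)[/(_ (DPhi a Da))[_ [z z0 az]] _]] := Phi_roots.
have az2 H H' :
    bracket (vsval H) (bracket (vsval H') z) = ((a H : K) * a H') *: z.
  by rewrite az linearZ /= az scalerA mulrC.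
have /eqP := az (vsproj h (bracket x y)).
rewrite vsprojK // bracket_bracketl -(vsprojK hx) -(vsprojK hy) !az2.
rewrite [X in X *: z - _]mulrC subrr eq_sym scaler_eq0 (negPf z0).
by rewrite orbF => /eqP.
Qed.

Lemma Xroot a : a \in Phi -> root_vector a (X a).
Proof. by case: X_chevalley => _ Xr _ _; apply: Xr. Qed.

(** The sum of the root spaces, as spanned by the Chevalley basis. *)
Definition root_span : {vspace g} := <<[seq X b | b <- Phi]>>%VS.

(** A comparison of dimensions: there are as many simple roots as the
    dimension of the dual of [h]. *)
Lemma span_tau : <<[seq vsval (tau Hd a) | a <- Delta]>>%VS = h.
Proof.
have [/basis_free/catr_free/eqP tau_free _ _ _] := X_chevalley.
have [_ /andP[/eqP Delta_span /eqP Delta_free] _] := Delta_base.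
apply/eqP; rewrite eqEdim; apply/andP; split.
  by apply/span_subvP => _ /mapP[a _ ->]; apply: subvsP.
rewrite tau_free size_map -Delta_free Delta_span dimvf.
by rewrite /dim /= muln1.
Qed.

Lemma root_span_cartan : (root_span + h = fullv)%VS.
Proof.
have [/andP[/eqP sp _] _ _ _] := X_chevalley.
by rewrite -span_tau -span_cat.
Qed.

Lemma root_span_disjoint : (root_span :&: h = 0)%VS.
Proof.
have [/basis_free fr _ _ _] := X_chevalley.
by move: fr; rewrite cat_free span_tau => /and3P[_ _ /directv_addP].
Qed.

Lemma root_span_stable H x :
  x \in root_span -> bracket (vsval H) x \in root_span.
Proof.
move=> Nx; have : ad g (vsval H) x \in (ad g (vsval H) @: root_span)%VS.
  exact: memv_img.
rewrite adE; apply: subvP; rewrite limg_span.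
apply/span_subvP => _ /mapP[_ /mapP[b Pb ->] ->].
by rewrite adE (Xroot Pb) memvZ // memv_span // map_f.
Qed.

(** Write [x = n + y] with [n] in the root span and [y] in [h].  Bracketing
    with [H] leaves the root span stable and kills [y], so that [c(H) y] lies in
    both summands. *)
Lemma root_vector_span c x : c != 0 -> root_vector c x -> x \in root_span.
Proof.
move=> /lfunPn[H cH0] cx; rewrite zero_lfunE in cH0.
have : x \in (root_span + h)%VS by rewrite root_span_cartan memvf.
case/memv_addP => n Nn [y hy def_x]; rewrite def_x in cx *.
have := cx H; rewrite linearD /= (cartan_abelian (subvsP H) hy) addr0 => cHn.
have : (c H : K) *: y \in (root_span :&: h)%VS.
  rewrite memv_cap (memvZ _ hy) andbT -(addKr ((c H : K) *: n) (_ *: y)).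
  by rewrite -scalerDr -cHn addrC memvB ?memvZ // root_span_stable.
rewrite root_span_disjoint memv0 scaler_eq0 (negPf cH0) /= => /eqP ->.
by rewrite addr0.
Qed.

(** If [- a] is not a root, no basis vector has a nonzero bracket with [X a]
    of weight 0, so bracketing with [X a] sends everything into the root span,
    whereas [[X a, X (- a)] = tau Hd a] is in [h]. *)
Lemma root_opp_of_tau a : a \in Phi -> tau Hd a != 0 -> - a \in Phi.
Proof.
move=> Pa tau0; have [_ _ Xtau _] := X_chevalley.
apply: contraNT tau0 => PNa.
have Na0 b : b \in Phi -> a + b != 0.
  by apply: contraTneq => /eqP; rewrite addrC addr_eq0 => /eqP ->.
have : vsval (tau Hd a) \in (root_span :&: h)%VS.
  rewrite memv_cap subvsP andbT -Xtau // -adE.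
  have : ad g (X a) (X (- a)) \in (ad g (X a) @: (root_span + h))%VS.
    by rewrite memv_img // root_span_cartan memvf.
  apply: subvP; rewrite limgD subv_add; apply/andP; split.
    rewrite limg_span; apply/span_subvP => _ /mapP[_ /mapP[b Pb ->] ->].
    rewrite adE (@root_vector_span (a + b)) ?Na0 //.
    by apply: root_vector_bracket; apply: Xroot.
  apply/subvP => _ /memv_imgP[y hy ->].
  rewrite adE bracketC -(vsprojK hy) (Xroot Pa) memvN memvZ //.
  by rewrite memv_span // map_f.
rewrite root_span_disjoint memv0 -(linear0 (vsval (U:=h))).
by move=> /eqP/val_inj ->.
Qed.

Lemma killing_cartan H H' :
  killing (vsval H) (vsval H') = \sum_(b <- Phi) (b H : K) * b H'.
Proof.
have [Xbasis _ _ _] := X_chevalley.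
pose cs : seq K := [seq (b H : K) * b H' | b <- Phi] ++ [seq 0 | a <- Delta].
transitivity (\sum_(a <- cs) a); last first.
  rewrite big_cat !big_map /= [X in _ + X]big1 ?addr0 //.
rewrite -(trace_diagonal (phi := (ad g (vsval H) \o ad g (vsval H'))%VF)
  (vbasisP fullv) Xbasis) ?size_cat ?size_map // => [|i lti].
  by apply: eq_bigr => i _; rewrite comp_lfunE !adE.
rewrite comp_lfunE !adE !nth_cat !size_map; case: ltnP => [ltiP|lePi].
  rewrite !(nth_map 0) //; set b := Phi`_i.
  by rewrite !(Xroot (mem_nth 0 ltiP)) linearZ /= (Xroot (mem_nth 0 ltiP))
    scalerA mulrC.
have ltiD : (i - size Phi < size Delta)%N by rewrite ltn_subLR.
by rewrite !(nth_map 0) // !cartan_abelian ?subvsP ?rpred0 ?linear0 ?scale0r.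
Qed.

Lemma killing_Hd a : a \in Phi ->
  killing (vsval (Hd a)) (vsval (Hd a)) = a (Hd a).
Proof. by move=> Pa; rewrite Hd_dual. Qed.

Lemma root_Hd_sym a b : a \in Phi -> b \in Phi -> a (Hd b) = b (Hd a).
Proof.
move=> Pa Pb; rewrite -(Hd_dual Pa) -(Hd_dual Pb) !killing_cartan.
by apply: eq_bigr => c _; rewrite mulrC.
Qed.

Lemma root_tau a b : a \in Phi -> b (tau Hd a) = (2 / a (Hd a)) * b (Hd a) :> K.
Proof. by move=> Pa; rewrite /tau linearZ /= killing_Hd. Qed.

Lemma root_tau_self a :
  a \in Phi -> a (Hd a) != 0 :> K -> a (tau Hd a) = 2 :> K.
Proof. by move=> Pa qa0; rewrite root_tau // divfK. Qed.

Lemma tau_neq0 a : a \in Phi -> a (Hd a) != 0 :> K -> tau Hd a != 0.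
Proof.
move=> Pa qa0; apply/eqP => tau0; have := root_tau_self Pa qa0.
by rewrite tau0 linear0 => /esym/eqP; rewrite pnatr_eq0.
Qed.

(** The relations hold for [a] as soon as [- a] is a root and the Killing norm
    of [Hd a] does not vanish; root_sl2 below removes these conditions, but its
    proof rests on this form applied to simple roots. *)
Lemma chevalley_sl2 (V : vectType K) (rho : 'Hom(g, 'End(V))) a :
    is_rep rho -> a \in Phi -> - a \in Phi -> a (Hd a) != 0 :> K ->
  sl2_triple (rho (X a)) (rho (X (- a))) (rho (vsval (tau Hd a))).
Proof.
move=> rho_rep Pa PNa qa0; have [_ _ Xtau _] := X_chevalley.
have tau2 := root_tau_self Pa qa0.
split=> v.
- by rewrite (rep_bracket rho_rep) Xtau.
- by rewrite (rep_root_vector rho_rep _ _ (Xroot Pa)) tau2.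
- by rewrite (rep_root_vector rho_rep _ _ (Xroot PNa)) opp_lfunE tau2 scaleNr.
Qed.

Lemma simple_root_Hd_neq0 a : a \in Delta -> a (Hd a) != 0 :> K.
Proof.
move=> Da; have [DPhi _ _] := Delta_base.
have [/basis_free/catr_free/free_not0 tau0 _ _ _] := X_chevalley.
apply/eqP => qa0; have /negP[] := tau0 _ (map_f (fun a => vsval (tau Hd a)) Da).
by rewrite /tau killing_Hd ?DPhi // qa0 invr0 mulr0 scale0r linear0.
Qed.

(** The Chevalley basis vector [X b] is an eigenvector of [ad (tau Hd a)], with
    eigenvalue [b (tau Hd a)]. *)
Lemma simple_tau_real a b : a \in Delta -> b \in Phi ->
  (b (tau Hd a) : K) \is Num.real.
Proof.
move=> Da Pb; have [DPhi _ _] := Delta_base; have Pa := DPhi a Da.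
have qa0 := simple_root_Hd_neq0 Da.
have [/basis_free Xfree _ _ _] := X_chevalley.
have Xb0 : X b != 0.
  by apply: (free_not0 Xfree); rewrite mem_cat map_f.
have PNa := root_opp_of_tau Pa (tau_neq0 Pa qa0).
apply: (sl2_eigenvalue_real (chevalley_sl2 (@ad_rep _ g) Pa PNa qa0) Xb0).
by rewrite adE (Xroot Pb).
Qed.

(** With [q] the Killing norm of [Hd a], the Killing norm of [tau Hd a] is
    [4 / q]; it is also a sum of squares of reals, hence [q] is real. *)
Lemma simple_Hd_real a b : a \in Delta -> b \in Phi ->
  (b (Hd a) : K) \is Num.real.
Proof.
move=> Da Pb; have [DPhi _ _] := Delta_base; have Pa := DPhi a Da.
have qa0 := simple_root_Hd_neq0 Da.
set q : K := a (Hd a) in qa0.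
have tauE c : c (tau Hd a) = (2 / q) * c (Hd a) :> K by rewrite root_tau.
pose r : K := \sum_(c <- Phi) (c (tau Hd a) : K) * c (tau Hd a).
have r_real : r \is Num.real.
  by rewrite /r big_seq rpred_sum // => c Pc; rewrite rpredM // simple_tau_real.
have def_r : r = 4 / q.
  rewrite /r; under eq_bigr do rewrite !tauE mulrACA.
  rewrite -mulr_sumr -killing_cartan killing_Hd // -/q mulrACA -natrM.
  by rewrite -mulrA mulfVK.
have -> : b (Hd a) = (q / 2) * b (tau Hd a) :> K.
  by rewrite tauE -[q / 2]invf_div mulKf // mulf_neq0 ?invr_eq0 ?pnatr_eq0.
have -> : q = 4 / r by rewrite def_r invf_div mulrC divfK ?pnatr_eq0.
by rewrite rpredM ?simple_tau_real ?rpred_div ?realn.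
Qed.

(** The pairing [b (Hd a)] is symmetric in [a] and [b] and additive in [a], so
    the case of a simple root [a] is enough. *)
Lemma root_Hd_real a b : a \in Phi -> b \in Phi -> (b (Hd a) : K) \is Num.real.
Proof.
move=> Pa Pb; have [DPhi _ /(_ a Pa) a_comb] := Delta_base.
have comb_real (l : dual h) : nat_comb Delta l -> (l (Hd b) : K) \is Num.real.
  case=> n ->; rewrite sum_lfunE big_seq; apply: rpred_sum => c Dc.
  rewrite -scaler_nat scale_lfunE rpredM ?realn //.
  by rewrite (root_Hd_sym (DPhi c Dc) Pb) simple_Hd_real.
rewrite (root_Hd_sym Pb Pa); case: a_comb => /comb_real //.
by rewrite opp_lfunE rpredN.
Qed.

(** The Killing norm of [Hd a] is the sum over the roots [b] of the squares of
    the reals [b (Hd a)].  If it vanishes then all roots vanish on [Hd a], so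
    [Hd a = 0] and [a], which is represented by [Hd a], is zero. *)
Lemma root_Hd_neq0 a : a \in Phi -> a (Hd a) != 0 :> K.
Proof.
move=> Pa; apply/eqP; rewrite -killing_Hd // killing_cartan => /eqP.
rewrite big_seq psumr_eq0 => [/allP Hda0|b Pb]; last first.
  by rewrite -expr2 real_exprn_even_ge0 // root_Hd_real.
have Ha0 : Hd a = 0.
  apply: base_separates => b /(let: And3 DPhi _ _ := Delta_base in DPhi b) Pb.
  by have := Hda0 b Pb; rewrite Pb /= mulf_eq0 orbb => /eqP.
have /eqP[] := root_neq0 Pa; apply/lfunP => H.
rewrite zero_lfunE -(Hd_dual Pa) killing_cartan Ha0 big1 // => b _.
by rewrite linear0 mulr0.
Qed.

Lemma root_opp a : a \in Phi -> - a \in Phi.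
Proof.
move=> Pa; exact: root_opp_of_tau Pa (tau_neq0 Pa (root_Hd_neq0 Pa)).
Qed.

Lemma root_sl2 (V : vectType K) (rho : 'Hom(g, 'End(V))) a :
    is_rep rho -> a \in Phi ->
  sl2_triple (rho (X a)) (rho (X (- a))) (rho (vsval (tau Hd a))).
Proof.
by move=> rho_rep Pa; apply: chevalley_sl2; rewrite ?root_opp ?root_Hd_neq0.
Qed.

Fact reflection_is_linear (a : dual h) :
  linear (fun H : subvs_of h => H - (a H : K) *: tau Hd a).
Proof.
move=> c H H'; move: (tau Hd a) => t.
by rewrite linearP /= scalerDl scalerBr opprD scalerA addrACA.
Qed.

Lemma reflectionE (a : dual h) H :
  reflection Hd a H = H - (a H : K) *: tau Hd a.
Proof.
pose refl := GRing.isLinear.Build _ _ _ _ _ (reflection_is_linear a).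
pose f : {linear _ -> _} :=
  HB.pack (fun H : subvs_of h => H - (a H : K) *: tau Hd a) refl.
exact: (lfunE f).
Qed.

Lemma reflectionK a : a \in Phi -> involutive (reflection Hd a).
Proof.
move=> Pa H.
have qa0 : a (Hd a) != 0 :> K := root_Hd_neq0 Pa.
have aH : a (reflection Hd a H) = - a H :> K.
  rewrite reflectionE linearB linearZ /= (root_tau_self Pa qa0).
  by rewrite -[_ *: _]/(_ * _) mulr_natr mulr2n opprD addNKr.
by rewrite [LHS]reflectionE aH reflectionE scaleNr opprK subrK.
Qed.

Lemma weyl_lift_reflection (V : vectType K) (rho : 'Hom(g, 'End(V))) N a
    (e := rho (X a)) (f := rho (X (- a))) :
    is_rep rho -> a \in Phi ->
    (forall v, iter N e v = 0) -> (forall v, iter N f v = 0) ->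
  forall H v, weyl_lift N e f (rho (vsval H) v)
    = rho (vsval (reflection Hd a H)) (weyl_lift N e f v).
Proof.
move=> rho_rep Pa e0 f0 H v.
rewrite (weyl_lift_weight e0 f0 (root_sl2 rho_rep Pa) (c := a H)) => [|u|u].
- rewrite -rep_subZ; congr (rho _ _); rewrite reflectionE.
  by move: (tau Hd a) => t; rewrite linearB linearZ.
- exact: (rep_root_vector rho_rep _ _ (Xroot Pa)).
- rewrite (rep_root_vector rho_rep _ _ (Xroot (root_opp Pa))).
  by rewrite opp_lfunE scaleNr.
Qed.

End ChevalleyBasis.

(** * Exponential series, compact form and unitarity *)

Section Unitarity.
Variables (C : numClosedFieldType) (V : vectType C).
Variable ip : {dot V for Num.conj}.

Lemma dot_conjC u v : ip u v = (ip v u)^*.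
Proof. by rewrite hermC /= mul1r. Qed.

Lemma adjointC (e f : 'End(V)) : (forall u v, ip (e u) v = ip u (f v)) ->
  forall u v, ip (f u) v = ip u (e v).
Proof. by move=> ef u v; rewrite dot_conjC -ef -dot_conjC. Qed.

(** The coefficients of the exponential series are real. *)
Lemma adjoint_lexp N (e f : 'End(V)) :
    (forall u v, ip (e u) v = ip u (f v)) ->
  forall u v, ip (lexp N e u) v = ip u (lexp N f v).
Proof.
move=> ef; have iter_ef k u v : ip (iter k e u) v = ip u (iter k f v).
  by elim: k u v => [|k IHk] u v //; rewrite iterSr IHk ef -iterS.
move=> u v; rewrite !lexpE linear_sumlz linear_sumr; apply: eq_bigr => k _.
by rewrite linearZl_LR linearZr_LR /= iter_ef fmorphV rmorph_nat.
Qed.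

(** The adjoint of [exp(e) exp(-f) exp(e)] is [exp(f) exp(-e) exp(f)], the
    inverse of the other expression [exp(-f) exp(e) exp(-f)] of the operator. *)
Lemma weyl_lift_unitary N (e f t : 'End(V)) :
    (forall v, iter N e v = 0) -> (forall v, iter N f v = 0) ->
    sl2_triple e f t ->
    (forall u v, ip (e u) v = ip u (f v)) ->
  forall u v, ip (weyl_lift N e f u) (weyl_lift N e f v) = ip u v.
Proof.
move=> e0 f0 sl2 ef u v; rewrite [in X in ip _ X](weyl_lift_swap e0 f0 sl2).
have nef u' v' : ip ((- f) u') v' = ip u' ((- e) v').
  rewrite !opp_lfunE linearNl linearNr.
  congr (- _); exact: adjointC ef _ _.
rewrite /weyl_lift opprK !comp_lfunE !(adjoint_lexp _ ef) !(adjoint_lexp _ nef).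
have ne0 w : iter N (- e) w = 0 by rewrite iter_opp e0 scaler0.
rewrite (lexp_oppK f0) -[e in lexp N e (lexp N (- f) v)]opprK (lexp_oppK ne0).
by rewrite (adjoint_lexp _ ef) (lexp_oppK f0).
Qed.

End Unitarity.

Section Exponential.
Variables (R : realType) (V : vectType R[i]).

Lemma is_exp_lexp N (A : 'End(V)) : (forall v, iter N A v = 0) ->
  is_exp A (lexp N A).
Proof.
move=> A0 v f; apply: cvg_near_cst; exists N => // M /= leNM.
by rewrite -lexpE (lexp_widen A0 leNM).
Qed.

End Exponential.

Section CompactForm.
Variables (R : realType) (g : lieAlgType R[i]) (V : vectType R[i]).
Variables (rho : 'Hom(g, 'End(V))) (h : {vspace g}).
Variables (Phi Delta : seq (dual h)) (Hd : dual h -> subvs_of h).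
Variables (X : dual h -> g) (ip : {dot V for Num.conj}).
Hypothesis inv_ip : invariant_form rho (compact_form Phi Delta Hd X) ip.

Lemma compact_generator_form x :
  compact_generator Phi Delta Hd X x -> compact_form Phi Delta Hd X x.
Proof.
move=> gx; have := real_spanD 1 gx (@real_span0 _ _ _).
by rewrite addr0 scale1r.
Qed.

(** The elements [X b - X (- b)] and ['i X b + 'i X (- b)] of the compact form
    act by skew-Hermitian operators; adding the two relations isolates [X b]. *)
Lemma pos_root_adjoint b : is_pos_root Phi Delta b ->
  forall u v, ip (rho (X b) u) v = ip u (rho (X (- b)) v).
Proof.
move=> b_pos u v.
have := inv_ip (compact_generator_form (compact_sub Hd X b_pos)) u v.
have := inv_ip (compact_generator_form (compact_add Hd X b_pos)) u v.
rewrite -scalerDr !linearZ /= !scale_lfunE linearZl_LR linearZr_LR /=.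
have ii0 : 'i%C != 0 :> R[i] by rewrite complexiE neq0Ci.
rewrite complexiE conjCi -complexiE mulNr opprK => /(mulfI ii0).
rewrite linearD linearB /= !add_lfunE !opp_lfunE.
rewrite !linearDl !linearDr !linearNl !linearNr /=.
move=> sumE diffE; apply: (mulIf (x := 2)); first by rewrite pnatr_eq0.
move: (congr2 +%R sumE diffE).
rewrite addrACA subrr addr0 opprB [RHS in _ = RHS -> _]addrC subrKA.
by rewrite !mulr_natr !mulr2n.
Qed.

End CompactForm.

(** * Lifting the Weyl group *)

Section WeylGroupLift.
Variables (R : realType) (g : lieAlgType R[i]) (V : vectType R[i]).
Variables (rho : 'Hom(g, 'End(V))) (h : {vspace g}).
Variables (Phi Delta : seq (dual h)) (Hd : dual h -> subvs_of h).
Variable X : dual h -> g.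
Hypotheses (rho_rep : is_rep rho) (h_cartan : is_cartan h).
Hypotheses (Phi_roots : is_root_system Phi) (Hd_dual : is_killing_dual Phi Hd).
Hypothesis Delta_base : is_base Phi Delta.
Hypothesis X_chevalley : is_chevalley_basis Phi Delta Hd X.

Let PhiN a : a \in Phi -> - a \in Phi :=
  root_opp h_cartan Phi_roots Hd_dual Delta_base X_chevalley (a := a).

Lemma root_adjoint ip a : invariant_form rho (compact_form Phi Delta Hd X) ip ->
  a \in Phi -> forall u v, ip (rho (X a) u) v = ip u (rho (X (- a)) v).
Proof.
move=> inv_ip Pa; have [_ _ /(_ a Pa)[a_pos|na_pos]] := Delta_base.
  exact: (pos_root_adjoint inv_ip).
have := pos_root_adjoint inv_ip (conj (PhiN Pa) na_pos); rewrite opprK.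
exact: adjointC.
Qed.

(** The properties of a lift which are stable under products and inverses.
    Injectivity of [s] is included because [s^-1] is only meaningful then. *)
Definition lifts (s : 'End(subvs_of h)) (T : 'End(V)) :=
  [/\ G_Z rho Phi X T, lker T == 0%VS, lker s == 0%VS,
      forall H v, T (rho (vsval H) v) = rho (vsval (s H)) (T v)
    & forall ip : {dot V for Num.conj},
        invariant_form rho (compact_form Phi Delta Hd X) ip ->
        forall u v, ip (T u) (T v) = ip u v].

Lemma reflection_lift a : a \in Phi -> exists T, lifts (reflection Hd a) T.
Proof.
move=> Pa; have PNa := PhiN Pa.
have sl2 := root_sl2 h_cartan Phi_roots Hd_dual Delta_base X_chevalley
  rho_rep Pa.
have [N [e0 f0]] := sl2_triple_nilpotent sl2.
set e := rho (X a) in e0 sl2; set f := rho (X (- a)) in f0 sl2.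
have [invE Ei] := lexp_opp_inv e0; have [invF Fi] := lexp_opp_inv f0.
exists (weyl_lift N e f); split.
- have GE : G_Z rho Phi X (lexp N e).
    by apply: generated_mem; exists a => //; apply: is_exp_lexp.
  have GF : G_Z rho Phi X (lexp N f).
    by apply: generated_mem; exists (- a) => //; apply: is_exp_lexp.
  rewrite /weyl_lift invF.
  exact: generated_comp (generated_comp GE (generated_inv GF)) GE.
- rewrite /weyl_lift invF.
  exact: lker0_comp (lker0_comp Ei (lker0_inv Fi)) Ei.
- apply/lker0P; apply: can_inj; exact: (reflectionK h_cartan Phi_roots Hd_dual
    Delta_base X_chevalley Pa).
- exact: (weyl_lift_reflection h_cartan Phi_roots Hd_dual Delta_base
    X_chevalley rho_rep Pa e0 f0).
- move=> ip inv_ip; apply: weyl_lift_unitary e0 f0 sl2 _.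
  exact: root_adjoint.
Qed.

Lemma weyl_group_lift s : weyl_group Phi Hd s -> exists T, lifts s T.
Proof.
elim=> [|r [a /= Pa <-]
  |s1 s2 _ [T1 [G1 T1i s1i T1H T1u]] _ [T2 [G2 T2i s2i T2H T2u]]
  |r _ [T [GT Ti si TH Tu]]].
- exists \1%VF; split=> [||| H v | ip _ u v]; rewrite ?id_lfunE //.
  + exact: generated_id.
  + by apply/lker0P => u v; rewrite !id_lfunE.
  + by apply/lker0P => u v; rewrite !id_lfunE.
- exact: reflection_lift.
- exists (T1 \o T2)%VF; split.
  + exact: generated_comp G1 G2.
  + exact: lker0_comp T1i T2i.
  + exact: lker0_comp s1i s2i.
  + by move=> H v; rewrite !comp_lfunE T2H T1H.
  + by move=> ip inv_ip u v; rewrite !comp_lfunE T1u // T2u.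
- exists (T^-1)%VF; split.
  + exact: generated_inv GT.
  + exact: lker0_inv Ti.
  + exact: lker0_inv si.
  + by move=> H v; apply: (elimT lker0P Ti); rewrite TH !lker0_lfunVK.
  + by move=> ip inv_ip u v; rewrite -(Tu ip inv_ip) !lker0_lfunVK.
Qed.

Lemma lifts_weight_space s T (mu : dual h) : lifts s T ->
  T @` weight_space rho mu = weight_space rho (weyl_act s mu).
Proof.
case=> _ Ti si TH _; apply/seteqP; split=> [_ [v /= mu_v <-] H | w /= mu_w].
  by rewrite -{1}(lker0_lfunVK si H) -TH mu_v linearZ /weyl_act comp_lfunE.
exists ((T^-1)%VF w); last exact: lker0_lfunVK.
move=> H; apply: (elimT lker0P Ti); rewrite TH linearZ /= !lker0_lfunVK // mu_w.
by rewrite /weyl_act comp_lfunE lker0_lfunK.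
Qed.

End WeylGroupLift.

Theorem proposition5p1 (R : realType) (g : lieAlgType R[i])
    (V : vectType R[i]) (rho : 'Hom(g, 'End(V))) (h : {vspace g})
    (Phi Delta : seq (dual h)) (Hd : dual h -> subvs_of h) (X : dual h -> g)
    (g_semisimple : is_semisimple g) (rho_rep : is_rep rho)
    (h_cartan : is_cartan h) (Phi_roots : is_root_system Phi)
    (Hd_dual : is_killing_dual Phi Hd) (Delta_base : is_base Phi Delta)
    (X_chevalley : is_chevalley_basis Phi Delta Hd X)
    (s : 'End(subvs_of h)) (Ws : weyl_group Phi Hd s) :
  exists T : 'End(V), G_Z rho Phi X T /\
    [/\ forall H : subvs_of h,
          (T \o rho (vsval H) \o T^-1)%VF = rho (vsval (s H)),
        (forall mu : dual h, is_nonzero_weight rho mu ->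
            T @` weight_space rho mu = weight_space rho (weyl_act s mu))
          /\ T @` weight_space rho (0 : dual h) = weight_space rho (0 : dual h)
      & forall ip : {dot V for Num.conj},
          invariant_form rho (compact_form Phi Delta Hd X) ip ->
          unitary_for ip T].
Proof.
have [T sT] := weyl_group_lift rho_rep h_cartan Phi_roots Hd_dual Delta_base
  X_chevalley Ws.
have [GT Ti si TH Tu] := sT.
exists T; split=> //; split.
- move=> H; apply/lfunP => v; rewrite !comp_lfunE TH.
  by rewrite lker0_lfunVK.
- split=> [mu _|]; rewrite (lifts_weight_space _ sT) //.
  by rewrite /weyl_act comp_lfun0l.
- by move=> ip inv_ip; split=> //; apply: Tu.
Qed.
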